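(* Let $n\ge 1$, $q\ge 2$ and $s\ge 0$ be integers, let $T_1,\ldots,T_n\subseteq\mathbb{R}$ be finite sets with $|T_i|=q$ for each $1\le i\le n$, and let $\mathcal{B}=\prod_{i=1}^n T_i\subseteq\mathbb{R}^n$. Let $\mathcal{A}\subseteq\mathcal{B}$ be an $s$-distance set. Then $$|\mathcal{A}|\leq \Big|\Big\{x_1^{\alpha_1}\cdots x_n^{\alpha_n}:\ 0\le\alpha_i\le q-1 \text{ for each } i,\ \text{and } \sum_{i}\alpha_i\le s\Big\}\Big|.$$
   Context: For $\mathcal{A}\subseteq\mathbb{R}^n$, let $d(\mathcal{A})=\{d(p_1,p_2): p_1,p_2\in\mathcal{A},\ p_1\neq p_2\}$ be the set of non-zero Euclidean distances among points of $\mathcal{A}$. The set $\mathcal{A}$ is an $s$-distance set if $|d(\mathcal{A})|\le s$. The right-hand side counts monomials in the variables $x_1,\ldots,x_n$, with integer exponents $\alpha_i$. *)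

(* Defs.v *)
From mathcomp Require Import all_boot all_order all_algebra.
From mathcomp Require Import finmap mpoly.
From mathcomp Require Import boolp classical_sets cardinality reals.

Set Implicit Arguments.
Unset Strict Implicit.
Unset Printing Implicit Defensive.

Import GRing.Theory Num.Theory.
Local Open Scope ring_scope.
Local Open Scope classical_set_scope.

(* The norm that mathcomp-analysis puts on 'rV[R]_n is the sup norm, hence the
   explicit Euclidean distance. *)
Definition edist (R : realType) (n : nat) (x y : 'rV[R]_n) : R :=
  Num.sqrt (\sum_(i < n) (x 0 i - y 0 i) ^+ 2).

Definition distances (R : realType) (n : nat) (A : set 'rV[R]_n) : set R :=
  [set d | exists p1 p2, [/\ A p1, A p2, p1 <> p2 & d = edist p1 p2]].

(* `I_s is the set {0, ..., s-1}, so this says that A has at most s distances;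
   in particular it has finitely many. *)
Definition is_distance_set (R : realType) (n s : nat) (A : set 'rV[R]_n) : Prop :=
  (distances A #<= `I_s)%card.

Definition grid (R : realType) (n : nat) (T : 'I_n -> {fset R}) : set 'rV[R]_n :=
  [set x | forall i, x 0 i \in T i].

Definition bounded_monomials (R : realType) (n q s : nat) : set {mpoly R[n]} :=
  [set 'X_[m] | m in
    [set m : 'X_{1..n} | (forall i, (m i <= q - 1)%N) /\ (\sum_(i < n) m i <= s)%N]].

Arguments bounded_monomials : clear implicits.

(* Main.v *)
Require Import Defs.
From mathcomp Require Import all_boot all_order all_algebra.
From mathcomp Require Import finmap mpoly.
From mathcomp Require Import boolp classical_sets cardinality reals.
From mathcomp Require Import zify ring.

Local Open Scope classical_set_scope.

(** Let [P(x, y)] be the product of [d^2 - |x - y|^2] over the distances [d] of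
    [A]. It has degree at most [2s], so each of its monomials [x^a y^b] has
    [|a| <= s] or [|b| <= s]. If a weight [f] on [A] is orthogonal to every
    monomial of degree at most [s], the sum of [f x * f y * P(x, y)] over
    [x, y] in [A] therefore vanishes. But [P] is zero off the diagonal and
    positive on it, so [f = 0]. On the grid, [x_i^q] is a combination of lower
    powers of [x_i], so it is enough that [f] is orthogonal to the monomials
    with exponents at most [q - 1]; hence [A] has at most as many points as
    there are such monomials (Petrov and Pohoata's form of the
    Croot-Lev-Pach argument). *)

Section DistanceSets.
Set Implicit Arguments.
Unset Strict Implicit.
Unset Printing Implicit Defensive.
Import GRing.Theory Num.Theory Order.TTheory.
Local Open Scope ring_scope.

Definition moment (R : comNzRingType) n m (x : 'I_m -> 'rV[R]_n)
    (f : 'I_m -> R) (e : 'I_n -> nat) : R :=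
  \sum_a f a * \prod_i x a 0 i ^+ e i.

(** Every element of [S] is a root of the monic polynomial [P] of degree [q] whose roots are the
    elements of [S]. *)
Lemma power_card_reduction (R : comNzRingType) q (S : {fset R}) :
  #|` S| = q ->
  exists c : 'I_q -> R, forall z, z \in S -> z ^+ q = \sum_j c j * z ^+ j.
Proof.
move=> Sq; pose P := \prod_(t <- S) ('X - t%:P).
have sP : size P = q.+1 by rewrite size_prod_XsubC -Sq.
have mP : P`_q = 1.
  have /monicP := monic_prod_XsubC (enum_fset S) xpredT id.
  by rewrite /lead_coef -/P sP.
exists (fun j => - P`_j) => z zS.
have : P.[z] = 0.
  by rewrite /P (big_rem z) //= hornerM hornerXsubC subrr mul0r.
rewrite horner_coef sP big_ord_recr /= mP mul1r addrC => /eqP.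
rewrite addr_eq0 => /eqP ->; rewrite -sumrN.
by apply: eq_bigr => j _; rewrite mulNr.
Qed.

Lemma grid_moments_vanish (R : comNzRingType) n q s m
    (T : 'I_n -> {fset R}) (x : 'I_m -> 'rV[R]_n) (f : 'I_m -> R) :
  (forall i, #|` T i| = q) -> (forall a i, x a 0 i \in T i) ->
  (forall e, (forall i, e i < q)%N -> (\sum_i e i <= s)%N ->
     moment x f e = 0) ->
  forall e, (\sum_i e i <= s)%N -> moment x f e = 0.
Proof.
move=> hT xT vanish e.
have [k] := ubnP (\sum_i e i)%N; elim: k => // k IH in e *.
rewrite ltnS => ek es.
have [/forallP eq|] := boolP [forall i, e i < q]%N; first exact: vanish.
rewrite negb_forall => /existsP[i]; rewrite -leqNgt => qe.
have [c cP] := power_card_reduction (hT i).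
(* Rewriting one factor [x_i ^+ q] turns the monomial [e] into the monomials [e' j]. As [j < q], the
   total degree drops, so the induction applies and the bound [s] is kept. *)
pose e' (j : 'I_q) l := if l == i then (e i - q + j)%N else e l.
have e'lt j : (\sum_l e' j l < \sum_l e l)%N.
  rewrite (bigD1 i) //= [X in (_ < X)%N](bigD1 i) //= /e' eqxx.
  rewrite (eq_bigr e) => [|l /negbTE -> //].
  by rewrite ltn_add2r; have := ltn_ord j; lia.
transitivity (\sum_(j < q) c j * moment x f (e' j)).
  under [RHS]eq_bigr do rewrite mulr_sumr.
  rewrite exchange_big /=; apply: eq_bigr => a _.
  rewrite (bigD1 i) //= -[X in _ ^+ X](subnK qe) exprD cP //.
  rewrite mulr_sumr mulr_suml mulr_sumr; apply: eq_bigr => j _.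
  rewrite [in RHS](bigD1 i) //= {1}/e' eqxx exprD.
  rewrite [in RHS](eq_bigr (fun l => x a 0 l ^+ e l)); last first.
    by move=> l /negbTE li; rewrite /e' li.
  by ring.
apply: big1 => j _; rewrite IH ?mulr0 //.
  exact: leq_trans (e'lt j) ek.
exact: leq_trans (ltnW (e'lt j)) es.
Qed.

(** Each monomial of [p] contributes a product of two moments, one for each half of the variables.
    As [msize] is the degree plus one, [p] has degree at most 2s + 1, so the two halves cannot both
    exceed [s]. *)
Lemma bilinear_sum_eq0 (R : comNzRingType) n s m (x : 'I_m -> 'rV[R]_n)
    (f : 'I_m -> R) (p : {mpoly R[n + n]}) :
  (msize p <= s.*2.+2)%N ->
  (forall e, (\sum_i e i <= s)%N -> moment x f e = 0) ->
  \sum_a \sum_b f a * f b * p.@[row_mx (x a) (x b) 0] = 0.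
Proof.
move=> sp vanish.
pose el (mm : 'X_{1..n + n}) i := mm (lshift n i).
pose er (mm : 'X_{1..n + n}) i := mm (rshift n i).
transitivity (\sum_(mm <- msupp p)
    p@_mm * (moment x f (el mm) * moment x f (er mm))).
  under [RHS]eq_bigr do rewrite big_distrlr mulr_sumr /=.
  rewrite [RHS]exchange_big; apply: eq_bigr => a _ /=.
  under [RHS]eq_bigr do rewrite mulr_sumr.
  rewrite [RHS]exchange_big; apply: eq_bigr => b _ /=.
  rewrite mevalE mulr_sumr; apply: eq_bigr => mm _.
  rewrite big_split_ord /=.
  under eq_bigr do rewrite row_mxEl.
  under [X in _ * (_ * (_ * X))]eq_bigr do rewrite row_mxEr.
  by rewrite mulrCA; congr (_ * _); rewrite mulrACA.
rewrite big_seq big1 // => mm mm_p.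
have deg : (\sum_i el mm i + \sum_i er mm i < s.*2.+2)%N.
  by have := leq_trans (msize_mdeg_lt mm_p) sp; rewrite mdegE big_split_ord.
have [le|gt] := leqP (\sum_i el mm i) s; first by rewrite vanish // mul0r mulr0.
by rewrite [moment x f (er mm)]vanish ?mulr0 //; lia.
Qed.

Lemma msize_mul_le (R : idomainType) n (p q : {mpoly R[n]}) a b :
  (msize p <= a.+1)%N -> (msize q <= b.+1)%N -> (msize (p * q) <= (a + b).+1)%N.
Proof.
have [->|p0] := eqVneq p 0; first by rewrite mul0r msize0.
have [->|q0] := eqVneq q 0; first by rewrite mulr0 msize0.
by rewrite msizeM //; lia.
Qed.

(** The first [n] variables stand for the coordinates of one point, the last [n] for those of the
    other. *)
Definition sqdist_poly (R : nzRingType) n : {mpoly R[n + n]} :=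
  \sum_i ('X_(lshift n i) - 'X_(rshift n i)) ^+ 2.

Lemma msize_sqdist_poly (R : idomainType) n : (msize (sqdist_poly R n) <= 3)%N.
Proof.
apply: leq_trans (msize_sum _ _ _) _; apply/bigmax_leqP_seq => i _ _.
have le2 : (msize ('X_(lshift n i) - 'X_(rshift n i) : {mpoly R[n + n]}) <= 2)%N.
  by apply: leq_trans (msizeD_le _ _) _; rewrite msizeN !msizeX !mdeg1.
by rewrite expr2; exact: (msize_mul_le le2 le2).
Qed.

Lemma meval_sqdist_poly (R : comNzRingType) n (x y : 'rV[R]_n) :
  (sqdist_poly R n).@[row_mx x y 0] = \sum_i (x 0 i - y 0 i) ^+ 2.
Proof.
rewrite /sqdist_poly raddf_sum; apply: eq_bigr => i _ /=.
by rewrite rmorphXn rmorphB /= !mevalXU row_mxEl row_mxEr.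
Qed.

Lemma edist_sqr (R : realType) n (x y : 'rV[R]_n) :
  edist x y ^+ 2 = \sum_i (x 0 i - y 0 i) ^+ 2.
Proof. by rewrite sqr_sqrtr // sumr_ge0 // => i _; rewrite sqr_ge0. Qed.

Lemma edist_neq0 (R : realType) n (x y : 'rV[R]_n) : x <> y -> edist x y != 0.
Proof.
move=> xy; apply/eqP => e0; apply: xy; apply/rowP => i; apply/eqP.
have /eqP := edist_sqr x y; rewrite e0 expr0n /= eq_sym psumr_eq0; last first.
  by move=> j _; rewrite sqr_ge0.
by move/allP/(_ i (mem_index_enum _)); rewrite /= sqrf_eq0 subr_eq0.
Qed.

Definition distance_poly (R : nzRingType) n (D : seq R) : {mpoly R[n + n]} :=
  \prod_(d <- D) ((d ^+ 2)%:MP - sqdist_poly R n).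

Lemma msize_distance_poly (R : idomainType) n (D : seq R) :
  (msize (distance_poly n D) <= (size D).*2.+1)%N.
Proof.
rewrite /distance_poly; elim: D => [|d D IH]; first by rewrite big_nil msize1.
rewrite big_cons doubleS; apply: (msize_mul_le (a := 2)) IH.
apply: leq_trans (msizeD_le _ _) _.
rewrite geq_max msizeN msize_sqdist_poly andbT.
by rewrite msizeC; case: (_ == _).
Qed.

Lemma meval_distance_poly (R : realType) n (D : seq R) (x y : 'rV[R]_n) :
  (distance_poly n D).@[row_mx x y 0] =
    \prod_(d <- D) (d ^+ 2 - edist x y ^+ 2).
Proof.
rewrite /distance_poly rmorph_prod; apply: eq_bigr => d _ /=.
by rewrite rmorphB /= mevalC meval_sqdist_poly edist_sqr.
Qed.

Lemma moments_vanish_eq0 (R : realType) n s m (D : seq R)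
    (x : 'I_m -> 'rV[R]_n) (f : 'I_m -> R) :
  (size D <= s)%N -> (forall d, d \in D -> d != 0) ->
  (forall a b, a != b -> edist (x a) (x b) \in D) ->
  (forall e, (\sum_i e i <= s)%N -> moment x f e = 0) ->
  forall a, f a = 0.
Proof.
move=> sD D0 xD vanish a.
have sP : (msize (distance_poly n D) <= s.*2.+2)%N.
  by apply: leq_trans (msize_distance_poly n D) _; rewrite ltnS ltnW // ltnS leq_double.
have Dgt0 : 0 < \prod_(d <- D) d ^+ 2.
  rewrite big_seq; apply: prodr_gt0 => d /D0 d0.
  by rewrite lt0r sqr_ge0 sqrf_eq0 d0.
have := bilinear_sum_eq0 sP vanish.
(* Off the diagonal, the factor of [distance_poly] at the distance itself vanishes; on it, the value
   is the product of the [d ^+ 2]. *)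
under eq_bigr => b _.
  rewrite (bigD1 b) //= big1 => [|c cb]; last first.
    rewrite meval_distance_poly (big_rem (edist (x b) (x c))) /=.
      by rewrite subrr mul0r mulr0.
    by rewrite xD // eq_sym.
  rewrite addr0 meval_distance_poly.
  under eq_bigr do rewrite edist_sqr.
  under eq_bigr => d _.
    rewrite big1; last by move=> i _; rewrite subrr expr0n.
    rewrite subr0; over.
  over.
(* What remains is a vanishing sum of squares [f b * f b] with a positive weight. *)
move/eqP; rewrite psumr_eq0 => [|b _]; last first.
  by rewrite mulr_ge0 ?(ltW Dgt0) // -expr2 sqr_ge0.
move/allP/(_ a (mem_index_enum _)) => /=.
by rewrite -expr2 mulf_eq0 (gt_eqF Dgt0) orbF sqrf_eq0 => /eqP.
Qed.

(** The finite type ['X_{1..n < s.+1}] already carries the degree bound [s]. *)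
Definition bounded_exponents n q s : pred 'X_{1..n < s.+1} :=
  fun e => [forall i, (e i <= q - 1)%N].
Arguments bounded_exponents : clear implicits.

Lemma card_grid_distance_set_le (R : realType) n q s m (D : seq R)
    (T : 'I_n -> {fset R}) (x : 'I_m -> 'rV[R]_n) :
  (0 < q)%N -> (forall i, #|` T i| = q) -> (forall a i, x a 0 i \in T i) ->
  (size D <= s)%N -> (forall d, d \in D -> d != 0) ->
  (forall a b, a != b -> edist (x a) (x b) \in D) ->
  (m <= #|bounded_exponents n q s|)%N.
Proof.
move=> q0 hT xT sD D0 xD; set K := bounded_exponents n q s.
pose M := \matrix_(a < m, k < #|K|)
  \prod_i x a 0 i ^+ (enum_val k : 'X_{1..n < s.+1}) i.
(* Independent rows give rank [m], which is at most the number of columns. A vector [u] in the left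
   kernel of [M] is a weight on the points. *)
suff /eqP <- : row_free M by exact: rank_leq_col.
apply: inj_row_free => u uM; apply/rowP => a; rewrite mxE.
apply: (@moments_vanish_eq0 _ _ s _ D x (u 0)) => // {a}.
apply: grid_moments_vanish hT xT _ => e eq es.
have degE : mdeg [multinom e i | i < n] = (\sum_i e i)%N.
  by rewrite mdegE; apply: eq_bigr => i _; rewrite mnmE.
have lt : (mdeg [multinom e i | i < n] < s.+1)%N by rewrite degE.
have kK : BMultinom lt \in K.
  by apply/forallP => i; rewrite /= mnmE subn1 -ltnS prednK.
(* The entry of [u *m M] in the column of [e] is the moment of [u] at [e]. *)
have /rowP/(_ (enum_rank_in kK (BMultinom lt))) := uM.
rewrite !mxE => <-; apply: eq_bigr => a _; rewrite mxE enum_rankK_in //.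
by congr (_ * _); apply: eq_bigr => i _; rewrite /= mnmE.
Qed.

Lemma card_bounded_exponents_le (R : realType) n q s :
  (`I_#|bounded_exponents n q s| #<= bounded_monomials R n q s)%card.
Proof.
set K := bounded_exponents n q s.
pose g (k : 'I_#|K|) : {mpoly R[n]} := 'X_[val (enum_val k)].
have g_inj : injective g.
  move=> k l /(congr1 (mcoeff (val (enum_val k)))) /eqP.
  rewrite !mcoeffX eqxx eqr_nat eq_sym eqb1 => /eqP/val_inj/enum_val_inj.
  by move->.
rewrite (card_le_eql (card_II (n := #|K|))).
rewrite -(card_le_eql (inj_card_eq (in2W g_inj))).
apply: subset_card_le => _ [k _ <-]; exists (val (enum_val k)) => //; split.
  by apply/forallP; exact: (enum_valP k).
by rewrite -mdegE -ltnS bmdeg.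
Qed.

(** An infinite [A] would contain a finite subset with more than [N] elements. This passes from
    indexed finite families of points to the set itself. *)
Lemma card_le_fsubsets (T : choiceType) (A : set T) N :
  (forall B : {fset T}, [set` B] `<=` A -> (#|` B| <= N)%N) ->
  (A #<= `I_N)%card.
Proof.
move=> leN; have [/finite_fsetP[B AB]|/infinite_set_fset] := pselect (finite_set A).
  rewrite AB (card_le_eql (introT card_eq_fsetP (erefl #|` B|))) card_le_II.
  by apply: leN; rewrite AB.
by move=> /(_ N.+1)[B /leN BN /leq_trans/(_ BN)]; rewrite ltnn.
Qed.

End DistanceSets.

Theorem corollary1p6 (R : realType) (n q s : nat)
  (hn : (1 <= n)%N) (hq : (2 <= q)%N)
  (T : 'I_n -> {fset R}) (hT : forall i : 'I_n, (#|` T i| = q)%fset)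
  (A : set 'rV[R]_n) (hAB : A `<=` grid T)
  (hA : is_distance_set s A) :
  (A #<= bounded_monomials R n q s)%card.
Proof.
have /finite_fsetP[D distD] : finite_set (distances A).
  exact: card_le_finite hA (finite_II s).
have sD : (size D <= s)%N.
  rewrite -card_le_II -(card_le_eql (introT card_eq_fsetP (erefl (size D)))) -distD.
  exact: hA.
apply: card_le_trans (card_bounded_exponents_le R n q s).
apply: card_le_fsubsets => B BA.
(* The default [0] is never reached, since [a] is below the size of [B]. *)
pose x (a : 'I_#|` B|) := nth 0%R B a.
have xA a : A (x a) by apply: BA; exact: mem_nth.
apply: (@card_grid_distance_set_le R n q s _ D T x) => //.
- exact: ltnW.
- by move=> a; exact: hAB.
- move=> d dD; have : distances A d by rewrite distD.
  by move=> [y [z [_ _ yz ->]]]; exact: edist_neq0.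
- move=> a b ab; have : distances A (edist (x a) (x b)); last by rewrite distD.
  exists (x a), (x b); split => // /eqP.
  by rewrite nth_uniq ?fset_uniq // => /eqP/val_inj/eqP; rewrite (negbTE ab).
Qed.
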